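(* For every regular language $L$ over a finite alphabet: $\mathrm{Member}(L)\in\mathrm{UDynProp}$ if and only if the syntactic monoid of $L$ is a group.
   Context: Dynamic descriptive complexity (Patnaik–Immerman). A word $w=w_1\cdots w_n$ with each $w_i\in\Sigma\cup\{\epsilon\}$ is encoded as the structure with domain $\{1,\dots,n\}$, a unary relation $W_\sigma$ for each $\sigma\in\Sigma$ and the linear order $\le$; each position lies in at most one $W_\sigma$ (otherwise it carries $\epsilon$), and the represented word is the concatenation of the non-$\epsilon$ symbols. Changes are $\mathrm{set}_\sigma(i)$, $\sigma\in\Sigma\cup\{\epsilon\}$, setting position $i$ to $\sigma$. A dynamic program stores auxiliary relations; for each auxiliary relation $R$ and each $\sigma$ it has an update formula $\varphi^R_\sigma(\bar x;y)$; after $\mathrm{set}_\sigma(i)$ the new $R$ is the set of tuples $\bar a$ with $\varphi^R_\sigma(\bar a;i)$ true in (changed word, old auxiliary relations). The initial word is $\epsilon^n$, auxiliary relations are initialized by a first-order formula. The program maintains $\mathrm{Member}(L)$ if a distinguished $0$-ary auxiliary relation is true exactly when the current word lies in $L$ after any sequence of changes. $\mathrm{UDynProp}$ is the class of problems maintainable by such programs using only auxiliary relations of arity at most $1$ and only quantifier-free update formulas. The syntactic monoid of a regular language is the transition monoid of its minimal deterministic automaton. *)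

(* Defs.v *)
From mathcomp Require Import all_boot.

Set Implicit Arguments.
Unset Strict Implicit.
Unset Printing Implicit Defensive.

(** * Words with blank positions

    Positions 1..n are represented by ['I_n]; [None] is the blank symbol
    [epsilon], so a position carries at most one letter by construction. *)

Definition language (Sigma : Type) := seq Sigma -> Prop.

Definition word (Sigma : Type) (n : nat) := n.-tuple (option Sigma).

Definition empty_word (Sigma : Type) (n : nat) : word Sigma n :=
  [tuple None | _ < n].

Definition content (Sigma : Type) (n : nat) (w : word Sigma n) : seq Sigma :=
  pmap id w.

Definition set_pos (Sigma : Type) (n : nat) (w : word Sigma n)
    (i : 'I_n) (s : option Sigma) : word Sigma n :=
  [tuple if j == i then s else tnth w j | j < n].

(** * First-order formulas

    [fo Sigma ar k] is the type of formulas with free variables among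
    x_0, ..., x_(k-1) over the vocabulary consisting of the unary [W_s]
    ([s : Sigma]), the linear order, equality, and one relation symbol of
    arity [ar R] for each [R : Aux].  In [FoEx f] the bound variable is
    x_0 of [f], and x_i outside the quantifier is x_(i+1) inside. *)

Inductive fo (Sigma Aux : Type) (ar : Aux -> nat) : nat -> Type :=
| FoTrue k : fo Sigma ar k
| FoW k (s : Sigma) (x : 'I_k) : fo Sigma ar k
| FoLe k (x y : 'I_k) : fo Sigma ar k
| FoEq k (x y : 'I_k) : fo Sigma ar k
| FoRel k (R : Aux) (xs : (ar R).-tuple 'I_k) : fo Sigma ar k
| FoNot k (f : fo Sigma ar k) : fo Sigma ar k
| FoAnd k (f g : fo Sigma ar k) : fo Sigma ar k
| FoEx k (f : fo Sigma ar k.+1) : fo Sigma ar k.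

Fixpoint quantifier_free (Sigma Aux : Type) (ar : Aux -> nat) (k : nat)
    (f : fo Sigma ar k) : bool :=
  match f with
  | FoNot _ g => quantifier_free g
  | FoAnd _ g h => quantifier_free g && quantifier_free h
  | FoEx _ _ => false
  | _ => true
  end.

Definition aux_state (Aux : Type) (ar : Aux -> nat) (n : nat) :=
  forall R : Aux, (ar R).-tuple 'I_n -> bool.

Fixpoint eval (Sigma : eqType) (Aux : Type) (ar : Aux -> nat) (n : nat)
    (w : word Sigma n) (S : aux_state ar n) (k : nat) (f : fo Sigma ar k) :
    k.-tuple 'I_n -> bool :=
  match f in fo _ _ k return k.-tuple 'I_n -> bool with
  | FoTrue _ => fun e => true
  | FoW _ s x => fun e => tnth w (tnth e x) == Some s
  | FoLe _ x y => fun e => tnth e x <= tnth e y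
  | FoEq _ x y => fun e => tnth e x == tnth e y
  | FoRel _ R xs => fun e => S R (map_tuple (tnth e) xs)
  | FoNot _ g => fun e => ~~ eval w S g e
  | FoAnd _ g h => fun e => eval w S g e && eval w S h e
  | FoEx _ g => fun e => [exists d : 'I_n, eval w S g (cons_tuple d e)]
  end.

(** The vocabulary without auxiliary relations. *)
Definition no_ar (v : void) : nat := match v with end.
Definition no_aux (n : nat) : aux_state no_ar n :=
  fun v => match v return (no_ar v).-tuple 'I_n -> bool with end.

(** * Dynamic programs *)

(** In the update formula [phi^R_s(x_1, ..., x_r; y)] with [r = arity R], the
    changed position [y] is variable 0 and [x_j] is variable [j]. *)
Record dyn_program (Sigma : finType) := DynProgram {
  aux : finType;
  arity : aux -> nat;
  query : aux;
  query_arity : arity query = 0;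
  init : forall R : aux, fo Sigma no_ar (arity R);
  update : forall R : aux, option Sigma -> fo Sigma arity (arity R).+1
}.

Definition change (Sigma : Type) (n : nat) := ('I_n * option Sigma)%type.

Section Run.

Variables (Sigma : finType) (P : dyn_program Sigma) (n : nat).

Definition config := (word Sigma n * aux_state (@arity _ P) n)%type.

Definition init_config : config :=
  (empty_word Sigma n,
   fun R a => eval (empty_word Sigma n) (@no_aux n) (init R) a).

Definition step (c : config) (ch : change Sigma n) : config :=
  let: (i, s) := ch in
  let w' := set_pos c.1 i s in
  (w', fun R a => eval w' c.2 (update R s) (cons_tuple i a)).

Definition run (cs : seq (change Sigma n)) : config :=
  foldl step init_config cs.

Definition query_value (c : config) : bool :=
  c.2 (query P) (tcast (esym (query_arity P)) [tuple]).

End Run.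

Definition word_problem (Sigma : Type) := forall n : nat, word Sigma n -> Prop.

Definition Member (Sigma : Type) (L : language Sigma) : word_problem Sigma :=
  fun n w => L (content w).

Definition maintains (Sigma : finType) (P : dyn_program Sigma)
    (Q : word_problem Sigma) : Prop :=
  forall (n : nat) (cs : seq (change Sigma n)),
    query_value (run P cs) <-> Q n (run P cs).1.

(** The initialization formulas may contain quantifiers. *)
Definition UDynProp (Sigma : finType) (Q : word_problem Sigma) : Prop :=
  exists P : dyn_program Sigma,
    [/\ forall R : aux P, arity R <= 1,
        forall (R : aux P) (s : option Sigma), quantifier_free (update R s)
      & maintains P Q].

(** * Automata and the syntactic monoid *)

Record dfa (Sigma : finType) := Dfa {
  state : finType;
  start : state;
  final : pred state;
  delta : state -> Sigma -> state
}.

Definition accepts (Sigma : finType) (A : dfa Sigma) (u : seq Sigma) : bool :=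
  final (foldl (@delta Sigma A) (start A) u).

Definition recognizes (Sigma : finType) (A : dfa Sigma) (L : language Sigma) :
    Prop :=
  forall u : seq Sigma, accepts A u <-> L u.

Definition regular (Sigma : finType) (L : language Sigma) : Prop :=
  exists A : dfa Sigma, recognizes A L.

Definition minimal_dfa (Sigma : finType) (A : dfa Sigma) (L : language Sigma) :
    Prop :=
  recognizes A L /\
  forall B : dfa Sigma, recognizes B L -> #|state A| <= #|state B|.

Definition transition (Sigma : finType) (A : dfa Sigma) (u : seq Sigma) :
    {ffun state A -> state A} :=
  [ffun q => foldl (@delta Sigma A) q u].

(** The underlying set of the transition monoid; the operation is composition
    and the unit is the identity map. *)
Definition transition_monoid (Sigma : finType) (A : dfa Sigma)
    (f : {ffun state A -> state A}) : Prop :=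
  exists u : seq Sigma, f = transition A u.

Lemma transition_monoid1 (Sigma : finType) (A : dfa Sigma) :
  transition_monoid (finfun (@id (state A))).
Proof. by exists [::]; apply/ffunP => q; rewrite !ffunE. Qed.

Lemma transition_monoidM (Sigma : finType) (A : dfa Sigma)
    (f g : {ffun state A -> state A}) :
  transition_monoid f -> transition_monoid g ->
  transition_monoid (finfun (g \o f)).
Proof.
move=> [u ->] [v ->]; exists (u ++ v).
by apply/ffunP => q; rewrite !ffunE /= !ffunE foldl_cat.
Qed.

(** For a set of maps that contains the identity and is closed under
    composition. *)
Definition is_group (T : finType) (M : {ffun T -> T} -> Prop) : Prop :=
  forall f, M f -> exists2 g, M g & cancel f g /\ cancel g f.

(** The minimal automaton of a regular language exists and is unique up to
    isomorphism, so it does not matter which one is taken. *)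
Definition syntactic_monoid_is_group (Sigma : finType) (L : language Sigma) :
    Prop :=
  exists2 A : dfa Sigma, minimal_dfa A L & is_group (@transition_monoid _ A).

(* Main.v *)
Require Import Defs.
From mathcomp Require Import all_boot all_fingroup zify.
From Stdlib Require Import Classical ClassicalEpsilon.

(** If every letter permutes the states, store for every position the product
    of the permutations strictly before it and up to it, and the product of the
    whole word.  After a change at i, a product that includes i is
    multiplied on the left by (new product up to i) * (old product up to i)^-1,
    which is determined by the values stored at i and the new letter.

    Conversely, suppose that the letter a is not injective on the states of the
    minimal automaton, and let p be a state outside its image, reached by u.
    Insert t + 1 letters a between two blocks of blanks.  Quantifier-free
    updates of unary relations only see the sequence of labels of the touched
    positions, so by Higman's lemma the structure obtained for some t embeds
    into the one obtained for a larger t'.  Overwriting the embedded positions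
    by u, blanks and z yields u z in the first structure and u a^r z with r > 0
    in the second, and the program answers the same.  Since a^r does not fix p,
    some z of bounded length separates the two words. *)

Set Implicit Arguments.
Unset Strict Implicit.
Unset Printing Implicit Defensive.

(** * Higman's lemma for finite alphabets *)

Lemma ex_argmin (X : Type) (P : X -> Prop) (m : X -> nat) :
  (exists x, P x) -> exists2 x, P x & forall y, P y -> m x <= m y.
Proof.
case=> x; have [k] := ubnP (m x); elim: k x => // k IHk x lexk Px.
have [[y [Py ltyx]]|nsm] := classic (exists y, P y /\ m y < m x).
  by apply: (IHk y) => //; apply: leq_trans ltyx lexk.
by exists x => // y Py; case: leqP => // ltyx; case: nsm; exists y.
Qed.

Lemma infinite_pigeonhole (T : finType) (h : nat -> T) :
  exists a, forall N, exists n, (N <= n) && (h n == a).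
Proof.
apply: NNPP => nex.
have bnd a : exists N, forall n, N <= n -> h n != a.
  apply: NNPP => nbnd; apply: nex; exists a => N; apply: NNPP => nn.
  apply: nbnd; exists N => n leNn; apply/negP => han.
  by apply: nn; exists n; rewrite leNn.
have [f fP] := fin_all_exists bnd.
have := fP (h (\max_a f a)) (\max_a f a).
by rewrite eqxx => /(_ (leq_bigmax _)).
Qed.

Section Higman.

Variable T : finType.
Implicit Types s : nat -> seq T.

Definition bad s := forall i j, i < j -> ~~ subseq (s i) (s j).

Definition agree n s s' := forall i, i < n -> s' i = s i.

(** The hypothesis [bad s] stands inside the existential so that description yields a total
    function, [minimize], which can be iterated. *)
Lemma bad_step n s : exists s', bad s ->
  [/\ bad s', agree n s s' &
      forall t, bad t -> agree n s t -> size (s' n) <= size (t n)].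
Proof.
have [bads|] := classic (bad s); last by exists s.
have [|s' [bads' ags'] mins'] :=
    @ex_argmin _ (fun t => bad t /\ agree n s t) (fun t => size (t n)).
  by exists s.
by exists s' => _; split=> // t badt agt; apply: mins'.
Qed.

Definition minimize n s := projT1 (constructive_indefinite_description _ (bad_step n s)).

(* Nash-Williams' minimal bad sequence. *)
Lemma higman s : exists i j, i < j /\ subseq (s i) (s j).
Proof.
apply: NNPP => nex.
have bads : bad s.
  by move=> i j ltij; apply/negP => sub; apply: nex; exists i, j.
have minP n t : bad t -> _ := projT2 (constructive_indefinite_description _ (bad_step n t)).
pose g := fix g n := if n is m.+1 then minimize m (g m) else s.
have badg n : bad (g n) by elim: n => //= n IHn; case: (minP n _ IHn).
have gP n : agree n (g n) (g n.+1) /\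
    forall t, bad t -> agree n (g n) t -> size (g n.+1 n) <= size (t n).
  by case: (minP n _ (badg n)).
have gE n m : n < m -> g m n = g n.+1 n.
  elim: m => // m IHm; rewrite ltnS leq_eqVlt => /predU1P[-> //|ltnm].
  by rewrite (proj1 (gP m)) // IHm.
(* Stage [n.+1] fixes entry [n] for good, so the diagonal [f] inherits badness and is minimal at
   every entry. *)
pose f n := g n.+1 n.
have badf : bad f.
  by move=> i j ltij; rewrite /f -(gE i j.+1) ?ltnS 1?ltnW //; apply: badg.
have minf n t : bad t -> agree n f t -> size (f n) <= size (t n).
  move=> badt agt; apply: (proj2 (gP n)) => // i ltin.
  by rewrite agt // /f gE.
have f_nil n : f n != [::].
  by apply/eqP => fn; have := badf n n.+1 (ltnSn n); rewrite fn sub0seq.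
have [x0 _] : exists x0 : T, true by case: (f 0) (f_nil 0) => // x; exists x.
have [a infa] := infinite_pigeonhole (fun n => head x0 (f n)).
pose next N := xchoose (infa N).
have nextP N : N <= next N /\ f (next N) = a :: behead (f (next N)).
  have /andP[leN /eqP <-] := xchooseP (infa N); split=> //.
  by rewrite -/(next N); case: (f _) (f_nil (next N)).
pose phi := fix phi k := if k is l.+1 then next (phi l).+1 else next 0.
have phi_ltS k : phi k < phi k.+1 by case: (nextP (phi k).+1).
have phi_lt k l : k < l -> phi k < phi l.
  elim: l => // l IHl; rewrite ltnS leq_eqVlt => /predU1P[-> //|/IHl ltkl].
  exact: ltn_trans ltkl (phi_ltS l).
have fphi k : f (phi k) = a :: behead (f (phi k)).
  by case: k => [|k]; apply: (proj2 (nextP _)).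
(* After the entries of [f] below [phi 0] come the words [f (phi k)] without their common first
   letter [a]. This is shorter than [f] at [phi 0], so its badness would contradict minimality. *)
pose t n := if n < phi 0 then f n else behead (f (phi (n - phi 0))).
suff badt : bad t.
  have := minf (phi 0) t badt; rewrite {2}/t ltnn subnn fphi /= ltnn => /(_ _)/negP.
  by apply=> // i lti; rewrite /t lti.
move=> i j ltij; rewrite /t; case: ltnP => lei; case: ltnP => lej.
- exact: badf.
- apply: contra (badf i (phi (j - phi 0)) _).
    by move=> /subseq_trans->//; rewrite [f (phi _)]fphi subseq_cons.
  apply: leq_trans lei _; case: (j - phi 0) => // k.
  by apply/ltnW/phi_lt.
- by rewrite ltnNge (leq_trans lei (ltnW ltij)) in lej.
- have := badf (phi (i - phi 0)) (phi (j - phi 0)).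
  rewrite fphi [f (phi (j - _))]fphi /= eqxx; apply; apply: phi_lt.
  by rewrite ltn_sub2r // (leq_ltn_trans lei).
Qed.

End Higman.

(** * Group languages *)

Lemma set_posE (Sigma : Type) n (w : word Sigma n) (i : 'I_n) s :
  set_pos w i s = take i w ++ s :: drop i.+1 w :> seq _.
Proof.
have si : size (take i w) = i by rewrite size_takel ?size_tuple // ltnW.
apply: (@eq_from_nth _ None).
  rewrite size_cat /= size_drop si !size_tuple card_ord; have := ltn_ord i; lia.
move=> k; rewrite size_tuple => ltkn; rewrite nth_cat si.
rewrite -[k in LHS]/(val (Ordinal ltkn)) -tnth_nth tnth_mktuple -val_eqE /=.
case: ltngtP => [ltki|ltik|->]; last by rewrite subnn.
  by rewrite nth_take // (tnth_nth None).
rewrite (tnth_nth None) /= -[k - i]prednK ?subn_gt0 //= nth_drop.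
by congr nth; lia.
Qed.

Section Formulas.

Variables (Sigma : finType) (Aux : Type) (ar : Aux -> nat) (k : nat).

Definition fo_or (f g : fo Sigma ar k) := FoNot (FoAnd (FoNot f) (FoNot g)).

Definition fo_big_or (fs : seq (fo Sigma ar k)) :=
  foldr fo_or (FoNot (FoTrue _ _ _)) fs.

Lemma eval_big_or n (w : word Sigma n) (S : aux_state ar n) fs e :
  eval w S (fo_big_or fs) e = has (fun f => eval w S f e) fs.
Proof. by elim: fs => //= f fs ->; rewrite negb_and !negbK. Qed.

Lemma qf_big_or (fs : seq (fo Sigma ar k)) :
  quantifier_free (fo_big_or fs) = all (@quantifier_free _ _ _ _) fs.
Proof. by elim: fs => //= f fs ->. Qed.

End Formulas.

Section GroupProgram.

Variables (Sigma : finType) (T : finType) (act : Sigma -> {perm T}).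

Local Notation G := {perm T}.
Local Open Scope group_scope.

Definition weight (o : option Sigma) : G := if o is Some s then act s else 1.

Definition prefix_prod n (w : word Sigma n) m := \prod_(o <- take m w) weight o.

(* [(Some false, F)], [(Some true, F)] and [(None, F)] say that the product of
   the letters strictly before x, up to x, and of the whole word is in [F]. *)
Definition prefix_ar (R : option bool * {set G}) : nat :=
  if R.1 is Some _ then 1 else 0.

Definition prefix_len (R : option bool * {set G}) n :
    (prefix_ar R).-tuple 'I_n -> nat :=
  match R with
  | (Some b, F) => fun a => b + thead (a : 1.-tuple _)
  | (None, F) => fun=> n
  end.
Arguments prefix_len : clear implicits.

(** Whether the changed position, variable 0, lies in the prefix that [R] measures. *)
Definition affected (R : option bool * {set G}) :
    fo Sigma prefix_ar (prefix_ar R).+1 :=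
  match R with
  | (Some true, F) => @FoLe Sigma _ prefix_ar 2 ord0 ord_max
  | (Some false, F) => FoNot (@FoLe Sigma _ prefix_ar 2 ord_max ord0)
  | (None, F) => @FoTrue Sigma _ prefix_ar 1
  end.

Definition at_pos (R : option bool * {set G}) (F : {set G}) :
    fo Sigma prefix_ar (prefix_ar R).+1 :=
  @FoRel Sigma _ prefix_ar (prefix_ar R).+1 (R.1, F)
    [tuple lift ord0 j | j < prefix_ar R].

Definition at_change k (b : bool) (h : G) : fo Sigma prefix_ar k.+1 :=
  @FoRel Sigma _ prefix_ar k.+1 (Some b, [set h]) [tuple ord0].

(** The disjunction guesses the old products [h] before and up to the changed position; only the
    true pair passes. Testing the new product against [R.2] then amounts to testing the old one
    against a translate of [R.2], which is again a stored relation because all sets serve as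
    indices. *)
Definition prefix_update (R : option bool * {set G}) (s : option Sigma) :
    fo Sigma prefix_ar (prefix_ar R).+1 :=
  fo_or (FoAnd (FoNot (affected R)) (at_pos R R.2))
    (FoAnd (affected R) (fo_big_or
      [seq FoAnd (FoAnd (at_change _ false h.1) (at_change _ true h.2))
         (at_pos R [set g | h.1 * weight s * h.2^-1 * g \in R.2])
         | h <- enum {: G * G}])).

Definition prefix_init (R : option bool * {set G}) : fo Sigma no_ar (prefix_ar R) :=
  if 1 \in R.2 then FoTrue _ _ _ else FoNot (FoTrue _ _ _).

Definition prefix_program (F : {set G}) : dyn_program Sigma :=
  @DynProgram Sigma (option bool * {set G})%type prefix_ar (None, F) erefl
    prefix_init prefix_update.

Lemma prefix_update_qf R s : quantifier_free (prefix_update R s).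
Proof.
have qa : quantifier_free (affected R) by case: R => [[[]|] F].
rewrite /prefix_update /= qa qf_big_or /=.
by rewrite all_map; apply/allP.
Qed.

(** The inverse factor cancels everything up to [i] and leaves the letters strictly after it, which
    the change does not touch. *)
Lemma prefix_prod_set_pos n (w : word Sigma n) (i : 'I_n) s m :
  prefix_prod (set_pos w i s) m =
    if i < m then prefix_prod w i * weight s * (prefix_prod w i.+1)^-1 *
                  prefix_prod w m
    else prefix_prod w m.
Proof.
rewrite /prefix_prod set_posE.
have si : size (take i w) = i by rewrite size_takel ?size_tuple // ltnW.
rewrite take_cat si; case: ltngtP => [lemi|ltim|->].
- by rewrite take_takel // ltnW.
- have -> : take m w = take i.+1 w ++ take (m - i.+1) (drop i.+1 w).
    by rewrite -takeD subnKC.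
  rewrite -[m - i]prednK ?subn_gt0 //= !big_cat big_cons /= !mulgA mulgKV.
  by rewrite subnS.
- by rewrite subnn cats0.
Qed.

Definition prefix_inv n (w : word Sigma n) (S : aux_state prefix_ar n) :=
  forall R a, S R a = (prefix_prod w (prefix_len R n a) \in R.2).

Lemma eval_affected n (w : word Sigma n) S R i a :
  eval w S (affected R) (cons_tuple i a) = (i < prefix_len R n a).
Proof.
case: R a => [[[]|] F] a //=.
- by rewrite /thead !(tnth_nth i) /= add1n ltnS.
- by rewrite /thead !(tnth_nth i) /= add0n -ltnNge.
- by rewrite ltn_ord.
Qed.

Lemma eval_at_pos n (w : word Sigma n) S R F i a :
  eval w S (at_pos R F) (cons_tuple i a) = S (R.1, F) a.
Proof.
rewrite /=; congr (S _ _); apply: eq_from_tnth => j.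
by rewrite tnth_map tnth_mktuple tnthS.
Qed.

Lemma eval_at_change n (w w' : word Sigma n) S k b h i a :
  prefix_inv w S ->
  eval w' S (@at_change k b h) (cons_tuple i a) = (prefix_prod w (b + i) == h).
Proof. by move=> invS /=; rewrite invS /= inE. Qed.

Lemma prefix_inv_step n (w : word Sigma n) S (i : 'I_n) s :
  prefix_inv w S ->
  prefix_inv (set_pos w i s)
    (fun R a => eval (set_pos w i s) S (prefix_update R s) (cons_tuple i a)).
Proof.
move=> invS R a; set w' := set_pos w i s.
have invSR F : S (R.1, F) a = (prefix_prod w (prefix_len R n a) \in F).
  by case: R a => [[b|] F'] a; rewrite invS.
have -> : eval w' S (prefix_update R s) (cons_tuple i a) =
    if i < prefix_len R n a then
      has (fun h => (prefix_prod w i == h.1) && (prefix_prod w i.+1 == h.2) &&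
        S (R.1, [set g | h.1 * weight s * h.2^-1 * g \in R.2]) a)
        (enum {: G * G})
    else S R a.
  rewrite /prefix_update /fo_or.
  rewrite -[LHS]/(~~ (~~ (~~ eval w' S (affected R) _ && eval w' S (at_pos R R.2) _)
     && ~~ (eval w' S (affected R) _ && eval w' S (fo_big_or _) _))).
  rewrite eval_affected eval_at_pos eval_big_or has_map.
  have -> : S (R.1, R.2) a = S R a by case: (R) (a).
  rewrite negb_and !negbK.
  case: ifP => _ /=; rewrite ?orbF //.
  apply: eq_has => h /=.
  congr (_ && _ && _).
  - exact: (@eval_at_change n w w' S (prefix_ar R) false h.1 i a invS).
  - exact: (@eval_at_change n w w' S (prefix_ar R) true h.2 i a invS).
  - exact: (eval_at_pos w' S _ i a).
rewrite prefix_prod_set_pos; case: ifP => _; last by rewrite invS.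
apply/hasP/idP => [[[h1 h2] _ /= /andP[/andP[/eqP <- /eqP <-]]]|prodF].
  by rewrite invSR inE.
exists (prefix_prod w i, prefix_prod w i.+1); first by rewrite mem_enum.
by rewrite !eqxx invSR inE.
Qed.

Lemma prefix_inv_run (F : {set G}) n cs :
  let c := run (n := n) (prefix_program F) cs in prefix_inv c.1 c.2.
Proof.
elim/last_ind: cs => [|cs [i s] IHcs] /=.
  move=> R a; rewrite /= /prefix_prod big1_seq.
    by rewrite /prefix_init; case: ifP.
  by move=> o /andP[_ /mem_take/mapP[j _ ->]].
by rewrite /run foldl_rcons; apply: prefix_inv_step.
Qed.

Lemma prefix_program_maintains (F : {set G}) :
  maintains (prefix_program F)
    (fun n w => \prod_(x <- content w) act x \in F).
Proof.
move=> n cs; rewrite /query_value prefix_inv_run /prefix_prod /=.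
rewrite take_oversize ?size_tuple //.
suff -> : \prod_(o <- (run (prefix_program F) cs).1) weight o =
  \prod_(x <- content (run (prefix_program F) cs).1) act x by [].
rewrite /content; elim: (tval _) => [|[x|] s IHs] /=; rewrite ?big_nil //.
  by rewrite !big_cons IHs.
by rewrite big_cons mul1g IHs.
Qed.

End GroupProgram.

Lemma injective_delta_UDynProp (Sigma : finType) (A : dfa Sigma)
    (L : language Sigma) :
  (forall x, injective (@delta _ A ^~ x)) -> recognizes A L ->
  UDynProp (Member L).
Proof.
move=> inj recA; pose act x := perm (@inj x).
(* Permutations compose from left to right, in the order in which a run reads its word. *)
exists (prefix_program act [set g : {perm state A} | final (g (start A))]); split.
- by case=> [[b|] F].
- exact: prefix_update_qf.
move=> n cs; rewrite prefix_program_maintains inE /Member -recA /accepts.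
suff -> : forall u q, foldl (@delta _ A) q u = (\prod_(x <- u) act x)%g q by [].
elim=> [|x u IHu] q /=; rewrite ?big_nil ?perm1 //.
by rewrite big_cons permM permE IHu.
Qed.

(** * Minimal automata *)

Section MinimalDfa.

Variables (Sigma : finType) (L : language Sigma).
Implicit Types A : dfa Sigma.

Lemma minimal_dfa_exists : regular L -> exists A, minimal_dfa A L.
Proof.
by case/(ex_argmin (fun A => #|state A|)) => A recA minA; exists A.
Qed.

(* Deleting [q] and sending its incoming transitions to [p] would give a smaller
   automaton; [E] relates the runs of the two automata. *)
Lemma minimal_dfa_redirect A (p q : state A) (E : state A -> state A -> Prop) :
  minimal_dfa A L -> p != q -> E (start A) (start A) ->
  (forall x y, E x y -> final x = final y) ->
  (forall x y a, E x y -> E (delta x a) (delta y a)) ->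
  ~ (forall x, E x q -> E x p).
Proof.
move=> [recA minA] pq E0 Ef Ed Eqp.
pose rd y : {x : state A | x != q} := insubd (exist _ p pq) y.
have Erd x y : E x y -> E x (val (rd y)).
  by move=> Exy; rewrite val_insubd; case: eqP Exy => //= ->; apply: Eqp.
pose B := @Dfa Sigma {x : state A | x != q} (rd (start A))
  (fun x => final (val x)) (fun x a => rd (delta (val x) a)).
have recB : recognizes B L.
  move=> u; rewrite -recA /accepts.
  suff -> : final (foldl (@delta _ B) (start B) u) =
            final (foldl (@delta _ A) (start A) u) by [].
  have: E (start A) (val (start B)) by apply: Erd.
  elim: u (start A) (start B) => [|a u IHu] x y Exy /=; first by rewrite (Ef _ _ Exy).
  by apply: IHu; apply/Erd/Ed.
have := minA B recB; rewrite card_sig /= (cardC1 q).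
by case: #|state A| (fintype0 q) => // n _; rewrite ltnn.
Qed.

(** An unreachable [q] could be redirected to the start state: with [E] equality on reachable
    states, nothing is related to [q]. *)
Lemma minimal_dfa_reachable A (q : state A) :
  minimal_dfa A L -> exists u, foldl (@delta _ A) (start A) u = q.
Proof.
move=> minA; apply: NNPP => nreach.
pose E x y := x = y /\ exists u, foldl (@delta _ A) (start A) u = x.
apply: (@minimal_dfa_redirect A (start A) q E) => //.
- by apply/eqP => eq0; apply: nreach; exists [::].
- by split=> //; exists [::].
- by move=> x y [->].
- by move=> x y a [<- [u <-]]; split=> //; exists (rcons u a); rewrite foldl_rcons.
- by move=> x [-> /nreach].
Qed.

(** Otherwise [q] could be merged into [p]; here [E] is the Nerode equivalence of states. *)
Lemma minimal_dfa_distinguishes A (p q : state A) :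
  minimal_dfa A L -> p != q ->
  exists z, final (foldl (@delta _ A) p z) != final (foldl (@delta _ A) q z).
Proof.
move=> minA pq; apply: NNPP => ndist.
pose E x y := forall z, final (foldl (@delta _ A) x z) = final (foldl (@delta _ A) y z).
apply: (@minimal_dfa_redirect A p q E) => //.
- by move=> x y /(_ [::]).
- by move=> x y a Exy z; apply: (Exy (a :: z)).
- move=> x Exq z; rewrite Exq; apply/eqP; apply: contraT => nz.
  by case: ndist; exists z; rewrite eq_sym.
Qed.

End MinimalDfa.

Lemma injective_delta_is_group (Sigma : finType) (A : dfa Sigma) :
  (forall x, injective (@delta _ A ^~ x)) -> is_group (@transition_monoid _ A).
Proof.
move=> inj f [u ->].
have foldI : injective (foldl (@delta _ A) ^~ u).
  by elim: u => [|x u IHu] // p q /= /IHu/inj.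
pose s := perm foldI.
(* The inverse of [s] is its power with exponent one less than its order. *)
exists (transition A (flatten (nseq #[s]%g.-1 u))); first by eexists.
have powE k q : foldl (@delta _ A) q (flatten (nseq k u)) = (s ^+ k)%g q.
  elim: k q => [|k IHk] q; first by rewrite expg0 perm1.
  by rewrite expgS permM /= foldl_cat IHk permE.
have sE q : foldl (@delta _ A) q u = s q by rewrite permE.
split=> q; rewrite !ffunE powE sE -permM -?expgS -?expgSr prednK ?order_gt0 //;
  by rewrite expg_order perm1.
Qed.

Lemma is_group_injective_delta (Sigma : finType) (A : dfa Sigma) x :
  is_group (@transition_monoid _ A) -> injective (@delta _ A ^~ x).
Proof.
case/(_ (transition A [:: x])) => [|g _ [fK _] p q /= eqpq]; first by exists [:: x].
by apply: (can_inj fK); rewrite !ffunE.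
Qed.

(** * Embeddings between runs *)

Section Simulation.

Variables (Sigma : finType) (n n' : nat) (e : 'I_n -> 'I_n').
Hypothesis eM : {mono e : x y / (x <= y)%N}.

Lemma le_mono_ord_inj : injective e.
Proof.
move=> x y exy; apply/val_inj/eqP.
by rewrite eqn_leq -[_ <= _]eM -[X in _ && X]eM exy leqnn.
Qed.

(** Atoms are preserved by [e], and without quantifiers no position outside the image of [e] is ever
    consulted. *)
Lemma eval_qf_embed Aux (ar : Aux -> nat) (w : word Sigma n) (w' : word Sigma n')
    (S : aux_state ar n) (S' : aux_state ar n') k (f : fo Sigma ar k) a :
  (forall x, tnth w' (e x) = tnth w x) ->
  (forall R b, S' R (map_tuple e b) = S R b) ->
  quantifier_free f -> eval w' S' f (map_tuple e a) = eval w S f a.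
Proof.
move=> ew eS; elim: f a => //= {k}.
- by move=> k s x a _; rewrite tnth_map ew.
- by move=> k x y a _; rewrite !tnth_map eM.
- by move=> k x y a _; rewrite !tnth_map (inj_eq le_mono_ord_inj).
- move=> k R xs a _; rewrite -eS; congr (S' _ _).
  by apply: eq_from_tnth => j; rewrite !tnth_map.
- by move=> k f IHf a /IHf->.
- by move=> k f IHf g IHg a /andP[/IHf-> /IHg->].
Qed.

Variable P : dyn_program Sigma.
Hypothesis Pqf : forall (R : aux P) s, quantifier_free (update R s).

Definition embeds (c : config P n) (c' : config P n') :=
  (forall x, tnth c'.1 (e x) = tnth c.1 x) /\
  (forall R b, c'.2 R (map_tuple e b) = c.2 R b).

Definition embed_change (ch : change Sigma n) : change Sigma n' := (e ch.1, ch.2).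

Lemma embeds_run c c' cs :
  embeds c c' ->
  embeds (foldl (@step _ P n) c cs) (foldl (@step _ P n') c' (map embed_change cs)).
Proof.
elim: cs c c' => //= [[i s]] cs IHcs c c' [ew eS]; apply: IHcs.
have ew' x : tnth (set_pos c'.1 (e i) s) (e x) = tnth (set_pos c.1 i s) x.
  by rewrite !tnth_mktuple (inj_eq le_mono_ord_inj) ew.
split=> //= R b; rewrite -(eval_qf_embed _ ew' eS) //; congr (eval _ _ _ _).
by apply: val_inj.
Qed.

Lemma embeds_query c c' : embeds c c' -> query_value c' = query_value c.
Proof.
case=> _ eS; rewrite /query_value -eS; congr (c'.2 _ _).
by apply: eq_from_tnth => j; move: (leq_trans (ltn_ord j) (eq_leq (query_arity P))).
Qed.

End Simulation.

Lemma subseq_codom_embed (T : eqType) n n' (f : 'I_n -> T) (f' : 'I_n' -> T) :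
  subseq (codom f) (codom f') ->
  exists2 e : 'I_n -> 'I_n', {mono e : x y / (x <= y)%N} & forall x, f' (e x) = f x.
Proof.
case/subseqP => m _; rewrite /codom /image_mem -map_mask => fE.
(* [s] lists the positions selected by the mask in increasing order; [e] sends [x] to its [x]-th
   entry. *)
set s := mask m (enum 'I_n') in fE.
have sz : size s == n by rewrite -(size_map f') -fE size_map size_enum_ord.
have sorted_s : sorted ltn (map val s).
  by rewrite map_mask val_enum_ord (subseq_sorted ltn_trans (mask_subseq _ _)) ?iota_ltn_sorted.
have valE (x : 'I_n) : val (tnth (Tuple sz) x) = nth 0 (map val s) x.
  rewrite (tnth_nth (tnth (Tuple sz) x)) /= (nth_map (tnth (Tuple sz) x)) //.
  by rewrite (eqP sz).
have homo (x y : 'I_n) : x < y -> tnth (Tuple sz) x < tnth (Tuple sz) y.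
  move=> ltxy; rewrite !valE; apply: (sorted_ltn_nth ltn_trans) => //;
    by rewrite inE size_map (eqP sz).
exists (tnth (Tuple sz)) => [x y|x].
  case: (ltngtP x y) => [/homo/ltnW//|/homo|/val_inj->]; last by rewrite leqnn.
  by rewrite ltnNge => /negbTE.
rewrite (tnth_nth (tnth (Tuple sz) x)) /= -(nth_map _ (f x)) ?(eqP sz) // -fE.
by rewrite (nth_map x) ?size_enum_ord // nth_ord_enum.
Qed.

(** The value written depends only on the position, so order and repetitions in [ys] do not
    matter. *)
Lemma run_wordE (Sigma : finType) (P : dyn_program Sigma) n (c : config P n)
    (v : 'I_n -> option Sigma) (ys : seq 'I_n) x :
  tnth (foldl (@step _ P n) c [seq (y, v y) | y <- ys]).1 x =
  if x \in ys then v x else tnth c.1 x.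
Proof.
elim: ys c => //= y ys IHys c; rewrite IHys inE tnth_mktuple.
by case: eqP => [->|_] /=; case: ifP.
Qed.

Lemma content_iota (Sigma : Type) n (w : word Sigma n) (g : nat -> option Sigma) :
  (forall x : 'I_n, tnth w x = g x) -> content w = pmap id [seq g k | k <- iota 0 n].
Proof.
move=> wg; congr (pmap id _); rewrite -val_enum_ord -map_comp.
rewrite -[LHS]map_tnth_enum; apply: eq_map => x; exact: wg.
Qed.

(** * The lower bound *)

Lemma tuple_arity_le1 (T : Type) k (a : k.-tuple T) (x0 : T) :
  k <= 1 -> exists x, a = nseq_tuple k x.
Proof.
case: k a => [|[|//]] a _; first by exists x0; rewrite (tuple0 a) [RHS]tuple0.
by case/tupleP: a => x a; exists x; apply: val_inj; rewrite (tuple0 a).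
Qed.

Section Padding.

Variables (Sigma : finType) (a : Sigma) (B C : nat).

(* The middle block of a word of length [B + t.+1 + C] is collapsed to the
   number [B], so that the padding positions keep the same numbers for all [t]. *)
Definition pad_index t k :=
  if k <= B then k else if k < B + t.+1 then B else k - t.

Definition padded n (w : word Sigma n) t :=
  forall x : 'I_n, tnth w x = if pad_index t x == B then Some a else None.

(** Every index other than [B] belongs to exactly one position in each structure, so an
    index-preserving [e] can miss only padding. *)
Lemma pad_index_onto t t' (e : 'I_(B + t.+1 + C) -> 'I_(B + t'.+1 + C)) y :
  (forall x, pad_index t' (e x) = pad_index t x) ->
  y \notin codom e -> pad_index t' y = B.
Proof.
move=> eI; apply: contraNeq => yB.
have [x xy] : exists x : 'I_(B + t.+1 + C), pad_index t x = pad_index t' y.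
  have ltk : (if y < B then y : nat else y - t' + t) < B + t.+1 + C.
    by have := ltn_ord y; case: (ltnP y B) => ?; lia.
  exists (Ordinal ltk); move: yB (ltn_ord y); rewrite /pad_index /= {ltk}.
  by case: (ltnP y B) => ?; repeat case: ifP => ?; lia.
suff -> : y = e x by apply: codom_f.
apply: val_inj; move: yB; rewrite -eI in xy; move: xy.
rewrite /pad_index /=; have := ltn_ord y; have := ltn_ord (e x).
by repeat case: ifP => ?; lia.
Qed.

(** Index [B] of the list is the blank between [u] and [z], so overwritten padding is erased. Past
    the end of the list the default [None] leaves the rest of the right block blank. *)
Lemma content_overwrite (u z : seq Sigma) t (w : word Sigma (B + t.+1 + C))
    (E : {pred nat}) :
  size u = B -> size z <= C ->
  (forall x : 'I_(B + t.+1 + C), tnth w x =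
     if E x then nth None (map Some u ++ None :: map Some z) (pad_index t x)
     else Some a) ->
  (forall k, ~~ E k -> k < B + t.+1 + C -> pad_index t k = B) ->
  content w = u ++ pmap id [seq (if E k then None else Some a) | k <- iota B t.+1] ++ z.
Proof.
move=> sizu sizz wE EB; rewrite (content_iota (g := fun k =>
  if E k then nth None (map Some u ++ None :: map Some z) (pad_index t k)
  else Some a)) // -addnA !iotaD !map_cat !pmap_cat add0n.
congr (_ ++ _ ++ _).
- rewrite -[RHS](map_pK (g := Some) (f := id)) //; congr (pmap _ _).
  apply: (@eq_from_nth _ None); rewrite !size_map size_iota // => k ltkB.
  have kI : pad_index t k = k by rewrite /pad_index ltnW.
  rewrite (nth_map 0) ?size_iota // nth_iota // kI nth_cat size_map sizu ltkB.
  by case: ifPn => // /EB; rewrite kI; lia.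
- congr (pmap _ _); apply/eq_in_map => k; rewrite mem_iota => /andP[leBk ltk].
  have -> : pad_index t k = B by rewrite /pad_index ltk; case: ltngtP leBk.
  by rewrite nth_cat size_map sizu ltnn subnn.
- have zE : pmap id (map Some z ++ nseq (C - size z) None) = z.
    rewrite pmap_cat map_pK // -[RHS]cats0; congr (_ ++ _).
    by elim: (C - size z).
  rewrite -[RHS]zE; congr (pmap _ _).
  apply: (@eq_from_nth _ None).
    by rewrite size_cat size_nseq !size_map size_iota subnKC.
  rewrite !size_map size_iota // => k ltkC.
  have kI : pad_index t (B + t.+1 + k) = B + k.+1.
    by rewrite /pad_index !ifF; lia.
  rewrite (nth_map 0) ?size_iota // nth_iota // kI nth_cat size_map sizu.
  rewrite ltnNge leq_addr addKn /=.
  case: ifPn => [_|/EB]; last by rewrite kI; lia.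
  by rewrite nth_cat nth_nseq; case: ltnP => // lezk; rewrite nth_default ?if_same.
Qed.

End Padding.

Lemma UDynProp_injective_delta (Sigma : finType) (L : language Sigma) (A : dfa Sigma) :
  minimal_dfa A L -> UDynProp (Member L) -> forall x, injective (@delta _ A ^~ x).
Proof.
move=> minA [P [ar1 Pqf PL]] a; apply/injectiveP.
have recA : recognizes A L by case: minA.
(* A surjection of a finite set is injective, so it suffices to exclude a state [p] outside the
   image. *)
have [/forallP onto|] := boolP [forall p, p \in codom (@delta _ A ^~ a)].
  apply: (leq_size_uniq (enum_uniq (state A))); first by move=> p _; apply: onto.
  by rewrite size_codom cardT.
rewrite negb_forall => /existsP[p np]; exfalso.
have [u up] := minimal_dfa_reachable p minA.
have [zf zfP] : exists zf, forall q, q != p ->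
    final (foldl (@delta _ A) p (zf q)) != final (foldl (@delta _ A) q (zf q)).
  apply: (@fin_all_exists _ (fun=> seq Sigma) (fun q z => q != p ->
    final (foldl (@delta _ A) p z) != final (foldl (@delta _ A) q z))) => q.
  case: eqVneq => [_|qp]; first by exists [::].
  by have [z] := minimal_dfa_distinguishes minA qp; rewrite eq_sym; exists z.
have pow_p r : 0 < r -> foldl (@delta _ A) p (nseq r a) != p.
  case: r => // r _; rewrite -addn1 nseqD cats1 foldl_rcons.
  by apply: contraNneq np => <-; apply: codom_f.
(* The separating word depends on how many letters [a] survive, known only after the embedding is
   found, so the right block has room for every [zf q]. *)
set B := size u; pose C := \max_q size (zf q).
pose N t := B + t.+1 + C.
pose fill t := [seq (y, Some a) | y : 'I_(N t) <- enum 'I_(N t) & pad_index B t y == B].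
pose c t := run P (fill t).
have cw t : padded a B (c t).1 t.
  move=> x; rewrite /c /run run_wordE mem_filter mem_enum andbT.
  by case: ifP => // _; rewrite tnth_mktuple.
(* As arities are at most 1, the constant tuples at [x] also record the 0-ary
   relations. *)
pose label t (x : 'I_(N t)) : 'I_(B + C).+1 * {ffun aux P -> bool} :=
  (inord (pad_index B t x), [ffun R => (c t).2 R (nseq_tuple (arity R) x)]).
(* The labels form one finite alphabet for all [t], since indices stay below [(B + C).+1]. *)
have [i [j [ltij /subseq_codom_embed[e eM eL]]]] := higman (fun t => codom (@label t)).
have eI x : pad_index B j (e x) = pad_index B i x.
  have lt_index t (y : 'I_(N t)) : pad_index B t y < (B + C).+1.
    by have := ltn_ord y; rewrite /N /pad_index; repeat case: ifP; lia.
  have [/(congr1 val) ] := eL x; by rewrite /= !inordK.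
have cE : embeds e (c i) (c j).
  split=> [x|R b]; first by rewrite !cw eI.
  have x0 : 'I_(N i) by exists 0; rewrite /N; lia.
  have [x ->] := tuple_arity_le1 b x0 (ar1 R).
  have [_ /ffunP/(_ R)] := eL x; rewrite !ffunE => <-; congr (_.2 _ _).
  by apply: eq_from_tnth => k; rewrite tnth_map !tnth_nseq.
pose mid E t : seq Sigma :=
  pmap id [seq (if E k then None else Some a) | k <- iota B t.+1].
pose Ej := [pred k | k \in map val (codom e)].
have midE E t : exists r, mid E t = nseq r a.
  rewrite /mid; elim: (iota _ _) => [|k s [r IHs]] /=; first by exists 0.
  by case: ifP => _ /=; [exists r|exists r.+1; rewrite IHs].
have [r rE] := midE Ej j.
(* The larger structure has a position missed by [e]; it is padding and keeps its [a]. *)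
have r_gt0 : 0 < r.
  have [y ny] : exists y, y \notin codom e.
    apply/existsP; rewrite -negb_forall; apply/negP => /forallP onto.
    have : #|'I_(N j)| <= size (codom e).
      by rewrite cardE; apply: uniq_leq_size (enum_uniq _) _ => y _.
    by rewrite size_codom !card_ord /N; lia.
  have yB := pad_index_onto eI ny.
  have : a \in mid Ej j.
    rewrite /mid mem_pmap map_id; apply/mapP; exists (nat_of_ord y).
      by rewrite mem_iota; move: yB (ltn_ord y); rewrite /pad_index /N;
        repeat case: ifP => ?; lia.
    by rewrite /Ej /= (mem_map val_inj) (negbTE ny).
  by rewrite rE mem_nseq => /andP[].
pose z := zf (foldl (@delta _ A) p (nseq r a)).
have sizz : size z <= C by apply: (leq_bigmax (F := fun q => size (zf q))).
pose v k := nth None (map Some u ++ None :: map Some z) k.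
(* These changes overwrite the whole smaller structure, but only the image of [e] in the larger
   one. *)
pose chs := [seq (x, v (pad_index B i x)) | x : 'I_(N i) <- enum 'I_(N i)].
pose wi := foldl (@step _ P _) (c i) chs.
pose wj := foldl (@step _ P _) (c j) (map (embed_change e) chs).
have contenti : content wi.1 = u ++ z.
  rewrite (@content_overwrite _ a B C u z i _ predT) // => [|x].
    by congr (_ ++ _); elim: (iota _ _).
  by rewrite run_wordE mem_enum.
have contentj : content wj.1 = u ++ nseq r a ++ z.
  rewrite -rE; apply: content_overwrite => // [y|k nk ltk].
    rewrite /wj; have -> : map (embed_change e) chs =
        [seq (y, v (pad_index B j y)) | y : 'I_(N j) <- codom e].
      by rewrite /codom /image_mem -!map_comp; apply: eq_map => x /=; rewrite eI.
    rewrite run_wordE /Ej /= (mem_map val_inj); case: ifP => // /negbT ny.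
    by rewrite cw (pad_index_onto eI ny) eqxx.
  apply: (pad_index_onto (y := Ordinal ltk) eI).
  by apply: contra nk => ke; apply/mapP; exists (Ordinal ltk).
(* [c t] is itself reached by a run, so the program is correct on all its continuations. *)
have Q t cs : accepts A (content (foldl (@step _ P (N t)) (c t) cs).1) =
    query_value (foldl (@step _ P (N t)) (c t) cs).
  rewrite /c /run -foldl_cat; apply/idP/idP => [/recA|] Hc; last exact/recA/PL.
  exact/PL.
have := zfP _ (pow_p r r_gt0); rewrite -/z -foldl_cat -up -!foldl_cat.
rewrite -[final _]/(accepts A (u ++ z)) -contenti Q.
rewrite -[final _]/(accepts A (u ++ nseq r a ++ z)) -contentj Q.
by rewrite (embeds_query (embeds_run eM Pqf chs cE)) eqxx.
Qed.

Theorem theorem2 (Sigma : finType) (L : language Sigma) (HL : regular L) :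
  UDynProp (Member L) <-> syntactic_monoid_is_group L.
Proof.
split=> [LU|[A [recA _] grA]].
  have [A minA] := minimal_dfa_exists HL; exists A => //.
  exact/injective_delta_is_group/(UDynProp_injective_delta minA).
apply: injective_delta_UDynProp recA => x.
exact: is_group_injective_delta.
Qed.
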